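(* Let $d\ge 2$ and let $E\subset\mathbb{F}_q^d$. Suppose that $\#E\gtrsim q^{\frac{d+1}{2}}$. Then $$\#\Delta(E)\ \gtrsim\ q .$$
   Context: $\mathbb{F}_q$ is the finite field with $q$ elements and $\mathbb{F}_q^d$ is the $d$-dimensional vector space over it. For $x\in\mathbb{F}_q^d$, $|x|^2=x_1^2+\dots+x_d^2\in\mathbb{F}_q$, and $\Delta(E)=\{|x-y|^2: x,y\in E\}\subset\mathbb{F}_q$. $\#$ denotes cardinality. $X\lesssim Y$ means that there exists $C>0$ (independent of $q$ and $E$) such that $X\le CY$, and $X\gtrsim Y$ means $Y\lesssim X$.
   Formalization: The hypothesis that q is odd is added; for even q the claim fails, since |x|^2=(x_1+...+x_d)^2, e.g. the hyperplane x_1+...+x_d=0 for d>=3 has only the distance 0, and for d=2 sets x_1+x_2 in S with S an additive subgroup of order about sqrt(q). *)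

(* Defs.v *)
From HB Require Import structures.
From mathcomp Require Import all_boot all_order all_algebra.

Set Implicit Arguments.
Unset Strict Implicit.
Unset Printing Implicit Defensive.

Import GRing.Theory.
Local Open Scope ring_scope.

(* |x|^2 = x_1^2 + ... + x_d^2, an element of the field (not a real norm). *)
Definition sqnorm (F : finFieldType) (d : nat) (x : 'rV[F]_d) : F :=
  \sum_(j < d) (x ord0 j) ^+ 2.

Definition distance_set (F : finFieldType) (d : nat) (E : {set 'rV[F]_d}) :
    {set F} :=
  [set sqnorm (x - y) | x in E, y in E].

(* Main.v *)
Require Import Defs.
From mathcomp Require Import all_boot all_order all_algebra finalg fingroup cyclic.
From mathcomp Require Import all_classical all_reals all_analysis.
From mathcomp Require Import ring lra.

Set Implicit Arguments.
Unset Strict Implicit.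
Unset Printing Implicit Defensive.

Import Order.TTheory GRing.Theory Num.Theory.
Local Open Scope ring_scope.

(** The idea is to view the distances from a point as a function on pairs.
    Put q = #|F| and, for y in F^d, let e_y be the function of (x, t) in
    F^d * F which is q - 1 when |x - y|^2 = t and -1 otherwise.  For
    y <> y' the equation |x - y|^2 = |x - y'|^2 is affine and nonconstant in x
    (here q odd enters), so it has exactly q^d / q solutions, and this is
    precisely what makes e_y and e_y' orthogonal ([orthogonal_deviations]).
    Hence the sum h of the e_y over y in E has squared norm at most
    #|E| q^(d+2) ([norm_sum_deviations]).  On the other hand, if E has m
    distances, then the sum of h over E * Delta(E) is #|E|^2 (q - m), because
    every pair of points of E realizes one t in Delta(E).  Cauchy-Schwarz on
    the rectangle E * Delta(E) gives
        #|E|^2 (q - m)^2 <= m q^(d+2)          ([few_values_bound]).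
    If #|E| >= C q^((d+1)/2) this reads C^2 (q - m)^2 <= m q, so m cannot be
    small compared with q. *)

(** * Cauchy-Schwarz over a finite set *)

(** Obtained by expanding the sum of (#|A| h - S)^2 over A, with S the sum
    of h. *)
Lemma sqr_sum_le_card (R : realFieldType) (I : finType) (A : {set I})
    (h : I -> R) :
  (\sum_(i in A) h i) ^+ 2 <= #|A|%:R * \sum_(i in A) h i ^+ 2.
Proof.
have [->|A0] := eqVneq A finset.set0.
  by rewrite !big_set0 cards0 mul0r expr0n.
set S := \sum_(i in A) h i; set Q := \sum_(i in A) _; set n : R := #|A|%:R.
have n0 : 0 < n by rewrite ltr0n card_gt0.
have : 0 <= \sum_(i in A) (n * h i - S) ^+ 2.
  by apply: sumr_ge0 => i _; exact: sqr_ge0.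
have -> : \sum_(i in A) (n * h i - S) ^+ 2 = n * (n * Q - S ^+ 2).
  transitivity (\sum_(i in A) (n ^+ 2 * h i ^+ 2 - 2 * n * S * h i + S ^+ 2)).
    by apply: eq_bigr => i _; ring.
  rewrite big_split /= sumrB -!mulr_sumr sumr_const -/S -/Q -mulr_natl -/n.
  by ring.
by rewrite pmulr_rge0 // subr_ge0.
Qed.

(** * Orthogonality for families with equidistributed bisectors *)

(** The normalisation makes [deviation f y] have zero sum over [p.2] for each
    fixed [p.1]. *)
Definition deviation (R : realFieldType) (X T : finType) (f : X -> X -> T)
    (y : X) (p : X * T) : R :=
  #|T|%:R * (f p.1 y == p.2)%:R - 1.

Lemma sum_indicator (R : realFieldType) (T : finType) (a : T) (D : {set T}) :
  a \in D -> \sum_(t in D) ((a == t)%:R : R) = 1.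
Proof.
move=> aD; rewrite (bigD1 a) //= eqxx big1 ?addr0 // => t /andP[_ ta].
by rewrite eq_sym (negbTE ta).
Qed.

Section Bisectors.

Variables (R : realFieldType) (X T : finType) (f : X -> X -> T).

Local Notation q := (#|T|%:R : R).
Local Notation N := (#|X|%:R : R).
Local Notation dev := (@deviation R X T f).

Lemma deviation_prod_row (x y y' : X) :
  \sum_t dev y (x, t) * dev y' (x, t) =
  q ^+ 2 * (f x y == f x y')%:R - q.
Proof.
rewrite /deviation /=.
transitivity (\sum_t (q ^+ 2 * ((f x y == t)%:R * (f x y' == t)%:R)
   - q * (f x y == t)%:R - q * (f x y' == t)%:R + 1)).
  by apply: eq_bigr => t _; ring.
have ind (a : T) : \sum_t ((a == t)%:R : R) = 1.
  rewrite -[RHS](@sum_indicator R T a finset.setT) ?inE //.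
  by apply: eq_bigl => t; rewrite inE.
have ind2 (a b : T) : \sum_t (((a == t)%:R : R) * (b == t)%:R) = (a == b)%:R.
  rewrite (bigD1 a) //= eqxx mul1r big1 ?addr0 1?eq_sym // => t ta.
  by rewrite eq_sym (negbTE ta) mul0r.
rewrite big_split /= !sumrB -!mulr_sumr ind2 !ind sumr_const mulr1.
by rewrite -[1 *+ _]/q; ring.
Qed.

Lemma deviation_prod (y y' : X) :
  \sum_p dev y p * dev y' p =
  q ^+ 2 * #|[set x | f x y == f x y']|%:R - q * N.
Proof.
rewrite -(pair_bigA _ (fun x t => dev y (x, t) * dev y' (x, t))) /=.
under eq_bigr do rewrite deviation_prod_row.
rewrite sumrB -mulr_sumr sumr_const -[q *+ _]mulr_natr; congr (_ * _ - _).
rewrite -natr_sum; congr (_%:R); rewrite -sum1_card [RHS]big_mkcond /=.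
by apply: eq_bigr => x _; rewrite inE; case: (_ == _).
Qed.

Hypothesis bisector : forall y y', y != y' ->
  (#|T| * #|[set x | f x y == f x y']|)%N = #|X|.

Lemma orthogonal_deviations (y y' : X) : y != y' ->
  \sum_p dev y p * dev y' p = 0.
Proof.
move=> yy'; rewrite deviation_prod -(bisector yy') natrM.
by ring.
Qed.

(** Pythagoras: only the diagonal terms survive. *)
Lemma norm_sum_deviations (E : {set X}) :
  \sum_p (\sum_(y in E) dev y p) ^+ 2 <= #|E|%:R * (q ^+ 2 * N).
Proof.
have -> : \sum_p (\sum_(y in E) dev y p) ^+ 2 =
    \sum_(y in E) \sum_p dev y p * dev y p.
  under eq_bigr do rewrite expr2 big_distrlr /=.
  rewrite exchange_big; apply: eq_bigr => y yE.
  rewrite exchange_big /= (bigD1 y) //= [X in _ + X]big1 ?addr0 //.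
  by move=> y' /andP[_ y'y]; rewrite orthogonal_deviations // eq_sym.
rewrite mulr_natl -sumr_const; apply: ler_sum => y _.
have -> : \sum_p dev y p * dev y p = q ^+ 2 * N - q * N.
  rewrite deviation_prod; congr (_ * _%:R - _).
  by rewrite -cardsT; apply: eq_card => x; rewrite !inE eqxx.
by rewrite gerBl mulr_ge0.
Qed.

Lemma sum_deviations_rectangle (E : {set X}) (D : {set T}) :
  (forall x y, x \in E -> y \in E -> f x y \in D) ->
  \sum_(p in finset.setX E D) \sum_(y in E) dev y p =
  #|E|%:R ^+ 2 * (q - #|D|%:R).
Proof.
move=> fED.
transitivity (\sum_(x in E) \sum_(t in D) \sum_(y in E) dev y (x, t)).
  rewrite [RHS]pair_big_dep /=; apply: eq_big => [[x t]|[x t] _] //=.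
  by rewrite finset.in_setX.
transitivity (\sum_(x in E) \sum_(y in E) (q - #|D|%:R)).
  apply: eq_bigr => x xE; rewrite exchange_big /=; apply: eq_bigr => y yE.
  by rewrite /deviation /= sumrB -mulr_sumr sum_indicator ?fED // mulr1 sumr_const.
by rewrite !sumr_const -mulrnA -[LHS]mulr_natl natrM -expr2.
Qed.

(** Cauchy-Schwarz on the rectangle [E * D], whose cardinality cancels the
    factor [#|E|] of [norm_sum_deviations]. *)
Lemma few_values_bound (E : {set X}) (D : {set T}) :
  (forall x y, x \in E -> y \in E -> f x y \in D) ->
  #|E|%:R ^+ 2 * (q - #|D|%:R) ^+ 2 <= #|D|%:R * (q ^+ 2 * N).
Proof.
move=> fED; set n : R := #|E|%:R; set m : R := #|D|%:R.
have [E0|E0] := eqVneq E finset.set0.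
  by rewrite /n E0 cards0 expr0n mul0r !mulr_ge0 // sqr_ge0.
have n0 : 0 < n by rewrite ltr0n card_gt0.
rewrite -(ler_pM2l (exprn_gt0 2 n0)).
have -> : n ^+ 2 * (n ^+ 2 * (q - m) ^+ 2) =
    (\sum_(p in finset.setX E D) \sum_(y in E) dev y p) ^+ 2.
  by rewrite sum_deviations_rectangle // -/n -/m; ring.
apply: le_trans (@sqr_sum_le_card _ _ _ _) _.
rewrite finset.cardsX natrM -/n -/m.
have -> : n ^+ 2 * (m * (q ^+ 2 * N)) = n * m * (n * (q ^+ 2 * N)) by ring.
rewrite ler_wpM2l ?mulr_ge0 //.
apply: le_trans (norm_sum_deviations E).
rewrite [leRHS](bigID (mem (finset.setX E D))) /= lerDl.
by apply: sumr_ge0 => p _; exact: sqr_ge0.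
Qed.

End Bisectors.

(** * Bisectors in a vector space over a finite field of odd order *)

Lemma odd_card_two_neq0 (F : finFieldType) : odd #|F| -> (2 : F) != 0.
Proof.
move=> oddF; apply/eqP => two0.
(* the order of the additive group kills 1, and 1 *+ #|F| = 1 if 2 = 0 *)
have : (1 : F) *+ #|F| = 0.
  by have := expg_cardG (finset.in_setT (1 : F)); rewrite cardsT FinRing.zmodXgE.
rewrite -[#|F|]odd_double_half oddF -muln2 mulnC mulrnDr mulrnA two0 mul0rn.
by rewrite addr0 => /eqP; rewrite oner_eq0.
Qed.

(** Translation by multiples of [e] permutes the fibres of [phi]
    transitively, so they all have the same cardinality. *)
Lemma card_fiber_translate (F : finFieldType) (V : finLmodType F)
    (phi : V -> F) (e : V) :
  (forall x s, phi (x + s *: e) = phi x + s) ->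
  (#|F| * #|[set x | (phi x == 0)%R]|)%N = #|V|.
Proof.
move=> phiD.
have fib b : #|[set x | phi x == b]| = #|[set x | phi x == 0]|.
  rewrite -(card_imset _ (@addIr V (- b *: e))); apply: eq_card => x.
  apply/imsetP/idP => [[z]|]; rewrite !inE => /eqP.
    by move=> zb ->; rewrite phiD zb subrr.
  move=> x0.
  exists (x + b *: e); first by rewrite inE phiD x0 add0r.
  by rewrite scaleNr addrK.
rewrite -sum_nat_const -[RHS]sum1_card (partition_big phi predT) //=.
apply: eq_bigr => b _; rewrite -(fib b) -sum1_card.
by apply: eq_bigl => x; rewrite inE.
Qed.

Lemma sqnorm_add_delta (F : finFieldType) (d : nat) (u : 'rV[F]_d) (a : F)
    (j : 'I_d) :
  sqnorm (u + a *: delta_mx ord0 j) = sqnorm u + 2 * a * u ord0 j + a ^+ 2.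
Proof.
rewrite /sqnorm (bigD1 j) //= [in RHS](bigD1 j) //= !mxE !eqxx /= mulr1.
have -> : \sum_(i < d | i != j) (u + a *: delta_mx ord0 j) ord0 i ^+ 2 =
    \sum_(i < d | i != j) u ord0 i ^+ 2.
  by apply: eq_bigr => i ij; rewrite !mxE (negbTE ij) andbF mulr0 addr0.
by ring.
Qed.

(** Along a coordinate where [y] and [y'] differ, the difference of the two
    square norms is affine of slope [2 * (y' - y)], which is nonzero. *)
Lemma card_bisector (F : finFieldType) (d : nat) (y y' : 'rV[F]_d) :
  odd #|F| -> y != y' ->
  (#|F| * #|[set x | (sqnorm (x - y) == sqnorm (x - y'))%R]|)%N = #|'rV[F]_d|.
Proof.
move=> /odd_card_two_neq0 two0; rewrite eq_sym -subr_eq0 => /rV0Pn[j].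
rewrite !mxE => yj.
set e := (2 * (y' ord0 j - y ord0 j))^-1 *: delta_mx ord0 j : 'rV[F]_d.
rewrite -(@card_fiber_translate F _ (fun x => sqnorm (x - y) - sqnorm (x - y')) e).
  by congr (_ * _)%N; apply: eq_card => x; rewrite !inE subr_eq0.
move=> x s; rewrite /e scalerA ![x + _ - _]addrAC !sqnorm_add_delta !mxE.
by field; apply/andP; split.
Qed.

(** * The distance set *)

Theorem corollary1p14 (R : realType) (d : nat) (hd : (2 <= d)%N)
    (C : R) (hC : 0 < C) :
  exists c : R, 0 < c /\
    forall (F : finFieldType) (E : {set 'rV[F]_d}),
      odd #|F| ->
      C * (#|F|%:R `^ (d.+1%:R / 2)) <= #|E|%:R ->
      c * #|F|%:R <= #|distance_set E|%:R.
Proof.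
have C2 : 0 < C ^+ 2 by rewrite exprn_gt0.
have den : 0 < 1 + 2 * C ^+ 2 by lra.
(* dropping m ^ 2 from C ^ 2 * (q - m) ^ 2 <= m * q leaves
   C ^ 2 * q <= (1 + 2 * C ^ 2) * m *)
exists (C ^+ 2 / (1 + 2 * C ^+ 2)); split; first by rewrite divr_gt0.
move=> F E oddF; set q : R := #|F|%:R => hE.
set D := distance_set E; set m : R := #|D|%:R.
have q0 : 0 < q by rewrite ltr0n; case: #|F| oddF.
have nE : C ^+ 2 * q ^+ d.+1 <= #|E|%:R ^+ 2.
  have -> : C ^+ 2 * q ^+ d.+1 = (C * q `^ (d.+1%:R / 2)) ^+ 2.
    rewrite exprMn -(powR_mulrn _ (powR_ge0 _ _)) -powRrM.
    by rewrite divfK ?pnatr_eq0 // powR_mulrn // ltW.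
  by rewrite ler_sqr // nnegrE ?mulr_ge0 ?powR_ge0 // ltW.
have fED x y : x \in E -> y \in E -> sqnorm (x - y) \in D.
  by move=> xE yE; exact: imset2_f.
have := @few_values_bound R _ _ _ (fun y y' => @card_bisector F d y y' oddF)
          E D fED.
rewrite card_mx mul1n natrX -/q -/m => few.
have key : C ^+ 2 * (q - m) ^+ 2 <= m * q.
  rewrite -(ler_pM2l (exprn_gt0 d.+1 q0)).
  have -> : q ^+ d.+1 * (m * q) = m * (q ^+ 2 * q ^+ d).
    by rewrite exprS; ring.
  apply: le_trans few; rewrite mulrA [q ^+ _ * _]mulrC.
  by rewrite ler_wpM2r ?sqr_ge0.
rewrite mulrAC ler_pdivrMr // -(ler_pM2r q0).
have : 0 <= C ^+ 2 * m ^+ 2 by rewrite mulr_ge0 ?sqr_ge0 // ltW.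
move: key; rewrite sqrrB; lra.
Qed.
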